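(* The following are equivalent for a class of graphs $\mathscr C$: (1) $\mathscr C$ is an FO-transduction of the class of all cubic graphs; (2) $\mathscr C$ is an FO-transduction of a class with bounded degree; (3) $\mathscr C$ is a perturbation of a class with bounded degree.
   Context: Graphs are finite, undirected and loopless; a class of graphs is a set of graphs considered up to isomorphism, and every class contains the empty graph. A cubic graph is a graph all of whose vertices have degree $3$. A class has bounded degree if there is a constant bounding the maximum degree of all its graphs. For a set $\mathcal U$ of unary relation symbols, a $\mathcal U$-colored graph is a graph with additional unary relations in $\mathcal U$. Formulas are first-order, with adjacency relation $E$. Transductions. For a positive integer $k$, the $k$-copy operation $\mathsf C_k$ maps a graph $G$ to the graph consisting of $k$ copies of $G$ in which the $k$ copies of each vertex are made pairwise adjacent (no other edges between the copies). The coloring operation $\Gamma_{\mathcal U}$ maps a graph to the set of all its $\mathcal U$-expansions. A simple interpretation $\mathsf I=(\nu(x),\eta(x,y))$ of graphs in $\mathcal U$-colored graphs is a pair of first-order formulas with $\eta$ symmetric and anti-reflexive; $\mathsf I(G^+)$ is the graph with vertex set $\nu(G^+)$ and edge set $\eta(G^+)\cap\nu(G^+)^2$. An (FO-)transduction is a composition $\mathsf T=\mathsf I\circ\Gamma_{\mathcal U}\circ\mathsf C_k$, so $\mathsf T(G)=\{\mathsf I(G^+): G^+\in\Gamma_{\mathcal U}(\mathsf C_k(G))\}$. For a class $\mathscr D$, $\mathsf T(\mathscr D)=\bigcup_{G\in\mathscr D}\mathsf T(G)$ up to isomorphism. A class $\mathscr C$ is an FO-transduction of $\mathscr D$ if $\mathscr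 C\subseteq\mathsf T(\mathscr D)$ for some transduction $\mathsf T$. Perturbations. A subset complementation is the transduction that chooses a subset $M$ of vertices (a unary relation) and complements the adjacency inside $M$. A perturbation is a composition of a bounded number of subset complementations. A class $\mathscr C$ is a perturbation of $\mathscr D$ if $\mathscr C\subseteq\mathsf P(\mathscr D)$ for some perturbation $\mathsf P$. *)

(* Defs.v *)
From mathcomp Require Import all_boot.

Set Implicit Arguments.
Unset Strict Implicit.
Unset Printing Implicit Defensive.

Record graph : Type := Graph {
  vertex :> finType;
  adj : rel vertex;
  adj_sym : symmetric adj;
  adj_irr : irreflexive adj }.

Arguments adj {g}.
Arguments Graph {vertex adj}.

Definition graph_iso (G H : graph) : Prop :=
  exists2 f : G -> H, bijective f & forall x y : G, adj (f x) (f y) = adj x y.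

Definition degree (G : graph) (x : G) : nat := #|[set y : G | adj x y]|.

(* "Up to isomorphism" is rendered by closure under isomorphism; every graph
   without vertices is an isomorphic copy of the empty graph. *)
Definition graph_class (C : graph -> Prop) : Prop :=
  (forall G H : graph, graph_iso G H -> C G -> C H) /\
  (forall G : graph, #|G| = 0 -> C G).

Definition cubic (G : graph) : Prop := forall x : G, degree x = 3.

Definition bounded_degree (C : graph -> Prop) : Prop :=
  exists d : nat, forall G : graph, C G -> forall x : G, degree x <= d.

Record colored_graph (U : Type) : Type := ColoredGraph {
  uncolored :> graph;
  color : U -> pred uncolored }.

Arguments ColoredGraph {U} uncolored color.

(* [formula U n] is the type of formulas with free variables among 0, ..., n-1
   (de Bruijn indices): under [FEx], index 0 is the newly bound variable and
   the other indices are shifted by one. *)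
Inductive formula (U : Type) : nat -> Type :=
| FEq n of 'I_n & 'I_n : formula U n
| FAdj n of 'I_n & 'I_n : formula U n
| FCol n of U & 'I_n : formula U n
| FNot n of formula U n : formula U n
| FAnd n of formula U n & formula U n : formula U n
| FEx n of formula U n.+1 : formula U n.

Arguments FEq {U n}.
Arguments FAdj {U n}.
Arguments FCol {U n}.

Fixpoint sat (U : Type) (G : colored_graph U) (n : nat) (phi : formula U n) :
    n.-tuple G -> bool :=
  match phi in formula _ m return m.-tuple G -> bool with
  | FEq _ i j => fun e => tnth e i == tnth e j
  | FAdj _ i j => fun e => adj (tnth e i) (tnth e j)
  | FCol _ c i => fun e => color c (tnth e i)
  | FNot _ p => fun e => ~~ sat p e
  | FAnd _ p q => fun e => sat p e && sat q e
  | FEx _ p => fun e => [exists x : G, sat p [tuple of x :: e]]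
  end.

Section Copy.
Variables (k : nat) (G : graph).

Definition copy_adj : rel (G * 'I_k) := fun x y =>
  (x.2 == y.2) && adj x.1 y.1 || (x.1 == y.1) && (x.2 != y.2).

Lemma copy_adj_sym : symmetric copy_adj.
Proof.
by move=> x y; rewrite /copy_adj adj_sym (eq_sym x.1) (eq_sym x.2).
Qed.

Lemma copy_adj_irr : irreflexive copy_adj.
Proof. by move=> x; rewrite /copy_adj adj_irr !eqxx. Qed.

Definition copy : graph := Graph copy_adj_sym copy_adj_irr.
End Copy.

Record interpretation (U : Type) : Type := Interpretation {
  nu : formula U 1;
  eta : formula U 2;
  eta_sym : forall (G : colored_graph U) (x y : G),
    sat eta [tuple x; y] = sat eta [tuple y; x];
  eta_irr : forall (G : colored_graph U) (x : G), sat eta [tuple x; x] = false }.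

Section Interpret.
Variables (U : Type) (I : interpretation U) (G : colored_graph U).

Definition interpret_vertex : finType := {x : G | sat (nu I) [tuple x]}.

Definition interpret_adj : rel interpret_vertex :=
  fun x y => sat (eta I) [tuple val x; val y].

Lemma interpret_adj_sym : symmetric interpret_adj.
Proof. by move=> x y; apply: eta_sym. Qed.

Lemma interpret_adj_irr : irreflexive interpret_adj.
Proof. by move=> x; apply: eta_irr. Qed.

Definition interpret : graph := Graph interpret_adj_sym interpret_adj_irr.
End Interpret.

Record transduction : Type := Transduction {
  copies : nat;
  copies_gt0 : 0 < copies;
  symbols : Type;
  interp : interpretation symbols }.

(* [transduce T D] is the set T(D), closed under isomorphism. *)
Definition transduce (T : transduction) (D : graph -> Prop) (H : graph) : Prop :=
  exists2 G : graph, D G &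
  exists c : symbols T -> pred (copy (copies T) G),
    graph_iso (interpret (interp T) (ColoredGraph _ c)) H.

Definition FO_transduction_of (C D : graph -> Prop) : Prop :=
  exists T : transduction, forall G : graph, C G -> transduce T D G.

Section SubsetComplementation.

Let x0 : 'I_2 := ord0.
Let x1 : 'I_2 := ord_max.

Let outside : formula unit 2 :=
  FAnd (FAdj x0 x1) (FNot (FAnd (FCol tt x0) (FCol tt x1))).
Let inside : formula unit 2 :=
  FAnd (FAnd (FCol tt x0) (FCol tt x1))
       (FAnd (FNot (FEq x0 x1)) (FNot (FAdj x0 x1))).

Definition sc_nu : formula unit 1 := FEq ord0 ord0.
Definition sc_eta : formula unit 2 :=
  FNot (FAnd (FNot outside) (FNot inside)).

Lemma sat_sc_eta (G : colored_graph unit) (x y : G) :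
  sat sc_eta [tuple x; y] =
  if color tt x && color tt y then (x != y) && ~~ adj x y else adj x y.
Proof.
rewrite /= !(tnth_nth x) /=.
by case: (color tt x); case: (color tt y); case: (adj x y); case: (x == y).
Qed.

Lemma sc_eta_sym (G : colored_graph unit) (x y : G) :
  sat sc_eta [tuple x; y] = sat sc_eta [tuple y; x].
Proof. by rewrite !sat_sc_eta adj_sym eq_sym andbC. Qed.

Lemma sc_eta_irr (G : colored_graph unit) (x : G) :
  sat sc_eta [tuple x; x] = false.
Proof. by rewrite sat_sc_eta adj_irr eqxx if_same. Qed.

End SubsetComplementation.

Definition subset_complementation : transduction :=
  @Transduction 1 isT unit (@Interpretation unit sc_nu sc_eta sc_eta_sym sc_eta_irr).

(* C is included in P(D), where P is a composition of n subset
   complementations; n does not depend on the graph. *)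
Definition perturbation_of (C D : graph -> Prop) : Prop :=
  exists n : nat, forall G : graph,
    C G -> iter n (transduce subset_complementation) D G.

(* Main.v *)
Require Import Defs.
From mathcomp Require Import all_boot.
From mathcomp Require Import zify.

(* A perturbation only changes adjacency by the parity of the number of chosen
   sets containing both ends.

   From a transduction of a class of bounded degree to a perturbation:
   first-order formulas are local. If two tuples of the same graph have
   isomorphic neighborhoods of a radius depending only on the formula, then
   they satisfy the same formula. Bounded degree leaves boundedly many
   neighborhood types, so for distant [x] and [y] the formula [eta x y] is a
   symmetric function of the types of [x] and [y]. Such a function is undone
   by a bounded number of subset complementations, after which adjacent
   vertices are close, hence of bounded degree.

   From a perturbation of a class of bounded degree to a transduction of cubic
   graphs: each vertex [v] is expanded into a path with one port per
   neighbor, and the ports of adjacent vertices are matched. This graph has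
   maximum degree 3 and is an induced subgraph of a cubic graph. Adjacency
   of [v] and [u] is recovered by walking boundedly far along both paths to
   two adjacent ports, and the perturbation is then applied by colors. *)

Set Implicit Arguments.
Unset Strict Implicit.
Unset Printing Implicit Defensive.

(** * Isomorphisms and subset complementations *)

Lemma inj_surj_bij (A : finType) (B : eqType) (f : A -> B) :
  injective f -> (forall y, exists x, f x == y) -> bijective f.
Proof.
move=> f_inj f_surj; exists (fun y => xchoose (f_surj y)) => [x|y].
  by apply: f_inj; apply/eqP/(xchooseP (f_surj (f x))).
exact/eqP/(xchooseP (f_surj y)).
Qed.

Lemma graph_iso_sym (G H : graph) : graph_iso G H -> graph_iso H G.
Proof.
case=> f [g fK gK] adj_f; exists g; first by exists f.
by move=> x y; rewrite -adj_f !gK.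
Qed.

Lemma graph_iso_trans (G H K : graph) :
  graph_iso G H -> graph_iso H K -> graph_iso G K.
Proof.
case=> f bij_f adj_f [g bij_g adj_g]; exists (g \o f); first exact: bij_comp.
by move=> x y; rewrite /= adj_g adj_f.
Qed.

Lemma degree_iso (G H : graph) (d : nat) :
  graph_iso G H -> (forall x : G, degree x <= d) -> forall y : H, degree y <= d.
Proof.
case=> f [g fK gK] adj_f degG y; apply: leq_trans (degG (g y)).
rewrite /degree -(card_imset _ (can_inj gK)) subset_leq_card //.
by apply/subsetP=> _ /imsetP[z + ->]; rewrite !inE -adj_f !gK.
Qed.

Lemma sat_iso (U : Type) (G H : colored_graph U) (f : G -> H) :
  bijective f ->
  (forall x y : G, adj (f x) (f y) = adj x y) ->
  (forall u (x : G), color u (f x) = color u x) ->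
  forall n (phi : formula U n) (e : n.-tuple G),
    sat phi (map_tuple f e) = sat phi e.
Proof.
move=> bij_f adj_f col_f n; have [g fK gK] := bij_f.
elim=> {n} [n i j|n i j|n u i|n p IHp|n p IHp q IHq|n p IHp] e /=;
  rewrite ?tnth_map ?IHp ?IHq //; first by rewrite (can_eq fK).
apply/existsP/existsP=> [[y]|[x]] sat_p.
  exists (g y); rewrite -IHp; move: sat_p; congr (sat p _).
  by apply: val_inj; rewrite /= gK.
by exists (f x); move: sat_p; rewrite -IHp; congr (sat p _); apply: val_inj.
Qed.

Lemma interpret_iso (U : Type) (I : interpretation U) (G H : colored_graph U)
    (f : G -> H) :
  bijective f ->
  (forall x y : G, adj (f x) (f y) = adj x y) ->
  (forall u (x : G), color u (f x) = color u x) ->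
  graph_iso (interpret I G) (interpret I H).
Proof.
move=> bij_f adj_f col_f; have satE := sat_iso bij_f adj_f col_f.
have sat1 (x : G) : sat (nu I) [tuple f x] = sat (nu I) [tuple x].
  by rewrite -satE; congr (sat _ _); apply: val_inj.
have nu_f (x : interpret I G) : sat (nu I) [tuple f (val x)].
  by rewrite sat1; apply: (valP x).
exists (fun x => Sub (f (val x)) (nu_f x) : interpret I H).
  apply: inj_surj_bij => [x y /(congr1 val) /= |y].
    by move/(bij_inj bij_f)/val_inj.
  have [g fK gK] := bij_f.
  have nu_g : sat (nu I) [tuple g (val y)] by rewrite -sat1 gK (valP y).
  by exists (Sub (g (val y)) nu_g); apply/eqP/val_inj => /=; rewrite gK.
move=> x y; rewrite /= /interpret_adj /= -satE.
by congr (sat _ _); apply: val_inj.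
Qed.

(** Subset complementation and the decoding of cubic graphs use a single copy; this removes the copy
    operation from both. *)
Lemma interpret_copy1 (U : Type) (I : interpretation U) (G : graph)
    (c : U -> pred (copy 1 G)) :
  graph_iso (interpret I (ColoredGraph G (fun u x => c u (x, ord0))))
            (interpret I (ColoredGraph (copy 1 G) c)).
Proof.
pose f x : ColoredGraph (copy 1 G) c := (x, ord0).
apply: (@interpret_iso _ _ (ColoredGraph _ _) _ f) => // [|x y].
  by exists fst => // -[x i]; rewrite /f [i]ord1.
by rewrite /= /copy_adj /= andbF orbF.
Qed.

Section Flips.
Variables (G : graph) (Ms : seq (pred G)).

Definition flips_adj : rel G := fun x y =>
  adj x y (+) ((x != y) && odd (count (fun M : pred G => M x && M y) Ms)).

Lemma flips_adj_sym : symmetric flips_adj.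
Proof.
move=> x y; rewrite /flips_adj adj_sym eq_sym; congr (_ (+) (_ && odd _)).
by apply: eq_count => M; rewrite andbC.
Qed.

Lemma flips_adj_irr : irreflexive flips_adj.
Proof. by move=> x; rewrite /flips_adj adj_irr eqxx. Qed.

Definition flips : graph := Graph flips_adj_sym flips_adj_irr.
End Flips.

Lemma flips_iso (G H : graph) : graph_iso G H ->
  forall Ms : seq (pred H), exists2 Ms' : seq (pred G),
    size Ms' = size Ms & graph_iso (flips Ms') (flips Ms).
Proof.
case=> f bij_f adj_f Ms.
exists [seq (fun x => M (f x)) | M : pred H <- Ms]; first by rewrite size_map.
exists f => // x y; rewrite /= /flips_adj adj_f (bij_eq bij_f) count_map.
by congr (_ (+) (_ && odd _)); apply: eq_count.
Qed.

Lemma flips_cat (G : graph) (Ms Ns : seq (pred G)) :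
  graph_iso (@flips (flips Ms) Ns) (flips (Ms ++ Ns)).
Proof.
exists id; first by exists id.
move=> x y; rewrite /= /flips_adj count_cat oddD /= /flips_adj -addbA.
by case: (x == y).
Qed.

Lemma flips_nil (G : graph) : graph_iso (@flips G [::]) G.
Proof.
by exists id; [exists id | move=> x y; rewrite /= /flips_adj andbF addbF].
Qed.

Lemma flips_twice (G : graph) (M : pred G) :
  graph_iso (@flips (flips [:: M]) [:: M]) G.
Proof.
apply: graph_iso_trans (flips_cat _ _) _; exists id; first by exists id.
by move=> x y; rewrite /= /flips_adj /= addn0 addnn odd_double andbF addbF.
Qed.

Lemma subset_complementation_flips (G : graph) (c : unit -> pred (copy 1 G)) :
  graph_iso (flips [:: fun x => c tt (x, ord0)])
            (interpret (interp subset_complementation)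
                       (ColoredGraph (copy 1 G) c)).
Proof.
apply: graph_iso_trans _ (interpret_copy1 _ _).
set I := interp _; set G' := ColoredGraph _ _.
have nuT (x : G') : sat (nu I) [tuple x] by rewrite /= eqxx.
exists (fun x => exist _ x (nuT x)).
  exists val => [x|x] //; exact: val_inj.
move=> x y; rewrite /= /interpret_adj sat_sc_eta /= /flips_adj /= addn0.
by case: (c tt _); case: (c tt _); rewrite /= ?andbT ?andbF ?addbF //=;
   case: eqVneq => [->|_]; rewrite ?adj_irr ?addbT ?addbF.
Qed.

Definition iso_closed (D : graph -> Prop) :=
  forall G H : graph, graph_iso G H -> D G -> D H.

Lemma transduce_iso_closed (T : transduction) (D : graph -> Prop) :
  iso_closed (transduce T D).
Proof.
move=> G H isoGH [K DK [c isoKG]]; exists K => //; exists c.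
exact: graph_iso_trans isoGH.
Qed.

Lemma iter_transduce_iso_closed (n : nat) (T : transduction)
    (D : graph -> Prop) :
  iso_closed D -> iso_closed (iter n (transduce T) D).
Proof. by case: n => // n _; apply: transduce_iso_closed. Qed.

(** Complementing the same set twice is the identity, so the set may be chosen on the output graph
    [H] instead of the input graph. *)
Lemma transduce_complementation (D : graph -> Prop) (H : graph) :
  iso_closed D ->
  transduce subset_complementation D H <-> exists M : pred H, D (flips [:: M]).
Proof.
move=> Dcl; split=> [[G DG [c isoGH]]|[M DM]].
  have /graph_iso_sym isoHG :=
    graph_iso_trans (subset_complementation_flips c) isoGH.
  have [[|M [|//]] // _ isoM] :=
    flips_iso isoHG [:: fun x : G => c tt (x, ord0)].
  exists M; apply: Dcl (DG); apply: graph_iso_sym.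
  exact: graph_iso_trans isoM (flips_twice _).
exists (flips [:: M]) => //; exists (fun _ p => M p.1).
apply: graph_iso_trans (graph_iso_sym (subset_complementation_flips _)) _.
exact: flips_twice.
Qed.

(** Complementation keeps the vertices, so sets chosen one after another can all be taken on [H] at
    once. *)
Lemma perturbation_flips (n : nat) (D : graph -> Prop) (H : graph) :
  iso_closed D ->
  iter n (transduce subset_complementation) D H <->
  exists2 Ms : seq (pred H), size Ms = n & D (flips Ms).
Proof.
move=> Dcl; elim: n H => [|n IHn] H /=.
  split=> [DH|[[|//] _]]; last by apply: Dcl (flips_nil H).
  by exists [::] => //; apply: Dcl DH; apply/graph_iso_sym/flips_nil.
apply: iff_trans (transduce_complementation H _) _.
  exact: iter_transduce_iso_closed.
split=> [[M /IHn[Ms <- DMs]]|[[|M Ms] //= [szMs] DMs]].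
  by exists (M :: Ms) => //; apply: Dcl DMs; apply: (flips_cat [:: M]).
exists M; apply/IHn; exists Ms => //; apply: Dcl DMs.
exact/graph_iso_sym/(flips_cat [:: M]).
Qed.

(** * Locality of first-order formulas *)

Section Balls.
Variable G : graph.
Implicit Types (A B : {set G}) (x y z : G) (r s : nat).

Definition enlarge A : {set G} :=
  [set y | (y \in A) || [exists x in A, adj x y]].

Definition ball r A : {set G} := iter r enlarge A.

Lemma in_enlarge A y :
  reflect (exists2 x, x \in A & (x == y) || adj x y) (y \in enlarge A).
Proof.
rewrite inE; apply: (iffP orP) => [[Ay|/exists_inP[x Ax xy]]|[x Ax]].
- by exists y; rewrite ?eqxx.
- by exists x; rewrite // xy orbT.
- by case/orP=> [/eqP<-|xy]; [left | right; apply/exists_inP; exists x].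
Qed.

Lemma in_ballS r A y :
  reflect (exists2 x, x \in ball r A & (x == y) || adj x y) (y \in ball r.+1 A).
Proof. exact: in_enlarge. Qed.

Lemma enlargeS A B : A \subset B -> enlarge A \subset enlarge B.
Proof.
move=> /subsetP sAB; apply/subsetP=> y /in_enlarge[x /sAB Bx xy].
by apply/in_enlarge; exists x.
Qed.

Lemma ballS r A B : A \subset B -> ball r A \subset ball r B.
Proof. by move=> sAB; elim: r => //= r; apply: enlargeS. Qed.

Lemma ballD r s A : ball (r + s) A = ball r (ball s A).
Proof. exact: iterD. Qed.

Lemma ball_leq r s A : r <= s -> ball r A \subset ball s A.
Proof.
move=> /subnK <-; elim: (s - r) => //= n /subset_trans-> //.
by apply/subsetP=> y; rewrite inE => ->.
Qed.

Lemma ballU r A B : ball r (A :|: B) = ball r A :|: ball r B.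
Proof.
elim: r => //= r ->; apply/setP=> y; rewrite in_setU.
apply/in_enlarge/orP => [[x + xy]|[] /in_enlarge[x xAB xy]].
- by rewrite inE => /orP[] xAB; [left | right]; apply/in_enlarge; exists x.
- by exists x; rewrite // inE xAB.
- by exists x; rewrite // inE xAB orbT.
Qed.

Lemma ball_sym r x y : (y \in ball r [set x]) = (x \in ball r [set y]).
Proof.
elim: r x y => [|r IHr] x y; first by rewrite !inE eq_sym.
suff sym u v : u \in ball r.+1 [set v] -> v \in ball r.+1 [set u].
  by apply/idP/idP; apply: sym.
case/in_ballS=> w; rewrite IHr => + wu; rewrite -addn1 ballD.
apply/subsetP/ballS; rewrite sub1set; apply/in_enlarge.
by exists u; rewrite ?inE // eq_sym adj_sym.
Qed.

Lemma card_ball (d : nat) r x :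
  (forall y, degree y <= d) -> #|ball r [set x]| <= d.+1 ^ r.
Proof.
move=> deg_d; elim: r => [|r IHr]; first by rewrite cards1.
rewrite expnSr; apply: leq_trans (leq_mul IHr (leqnn _)).
rewrite -sum_nat_const.
have /subset_leq_card/leq_trans-> // :
    ball r.+1 [set x] \subset
      \bigcup_(y in ball r [set x]) (y |: [set z | adj y z]).
  apply/subsetP=> z /in_ballS[y By yz]; apply/bigcupP; exists y => //.
  by rewrite !inE eq_sym.
apply: (big_ind2 (fun A n => #|A| <= n)) => [|A m B n leA leB|y _].
- by rewrite cards0.
- by apply: leq_trans (leq_add leA leB); rewrite leq_card_setU.
- by rewrite cardsU1 -add1n leq_add ?leq_b1 ?deg_d.
Qed.

End Balls.

(** * Isomorphisms between neighborhoods of tuples *)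

Section LocalIsomorphisms.
Variables (G : graph) (K : Type) (col : G -> K).
Implicit Types (f g : G -> G) (e : seq G) (x y c : G) (r s : nat).

(** A partial isomorphism given by total maps, whose values outside the two balls are irrelevant.
    Both tuples live in one graph, so that [g] can be iterated in [locally_iso_extend]. *)
Record local_iso f g r e e' : Prop := LocalIso {
  liso_map : map f e = e';
  liso_l : forall x, x \in ball r [set:: e] ->
    [/\ f x \in ball r [set:: e'], g (f x) = x & col (f x) = col x];
  liso_r : forall y, y \in ball r [set:: e'] ->
    g y \in ball r [set:: e] /\ f (g y) = y;
  liso_adj : {in ball r [set:: e] &, forall x y, adj (f x) (f y) = adj x y} }.

Definition locally_iso r e e' := exists f g, local_iso f g r e e'.

Lemma seq_sub_ball r e : {subset e <= ball r [set:: e]}.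
Proof.
by move=> x ex; apply: (subsetP (ball_leq _ (leq0n r))); rewrite inE.
Qed.

Lemma local_iso_sym f g r e e' : local_iso f g r e e' -> local_iso g f r e' e.
Proof.
case=> <- fP gP adjP; split=> [|y By|x Bx|y z By Bz].
- rewrite -map_comp map_id_in // => x ex /=.
  by case: (fP x) => //; apply: seq_sub_ball.
- have [Bx fgy] := gP y By; split=> //.
  by have [_ _ <-] := fP _ Bx; rewrite fgy.
- by case: (fP x Bx).
- have [[Bgy fgy] [Bgz fgz]] := (gP y By, gP z Bz).
  by rewrite -adjP // fgy fgz.
Qed.

Lemma locally_iso_sym r e e' : locally_iso r e e' -> locally_iso r e' e.
Proof. by case=> f [g /local_iso_sym]; exists g, f. Qed.

Lemma locally_iso_refl r e : locally_iso r e e.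
Proof. by exists id, id; split; rewrite ?map_id. Qed.

Lemma locally_iso_trans r e1 e2 e3 :
  locally_iso r e1 e2 -> locally_iso r e2 e3 -> locally_iso r e1 e3.
Proof.
case=> f1 [g1 [<- fP1 gP1 adj1]] [f2 [g2 [<- fP2 gP2 adj2]]].
exists (f2 \o f1), (g1 \o g2); split=> [|x Bx|z Bz|x y Bx By] /=.
- by rewrite map_comp.
- have [B1 g1K <-] := fP1 x Bx; have [B2 g2K <-] := fP2 _ B1.
  by rewrite g2K.
- by have [B1 f2K] := gP2 z Bz; have [B2 f1K] := gP1 _ B1; rewrite f1K.
- by have [[Bfx _ _] [Bfy _ _]] := (fP1 x Bx, fP1 y By); rewrite adj2 ?adj1.
Qed.

Lemma local_iso_ball f g r e e' s (A : {set G}) :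
  local_iso f g r e e' -> ball s A \subset ball r [set:: e] ->
  forall x, x \in ball s A -> f x \in ball s (f @: A).
Proof.
case=> _ _ _ adj_f; elim: s => [|s IHs] sAB x; first exact: imset_f.
have sAB' := subset_trans (ball_leq A (leqnSn s)) sAB.
move=> Ax; have /in_ballS[y By yx] := Ax.
apply/in_ballS; exists (f y); first exact: IHs.
rewrite adj_f; [|exact: subsetP sAB' y By|exact: subsetP sAB x Ax].
by case/orP: yx => [/eqP->|->]; rewrite ?eqxx ?orbT.
Qed.

Lemma set_seq_map f e : f @: [set:: e] = [set:: map f e].
Proof.
apply/setP=> y; rewrite inE; apply/imsetP/mapP => -[x];
  by rewrite ?inE => ex ->; exists x; rewrite ?inE.
Qed.

Lemma local_iso_restrict f g r e e' s t e1 :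
    local_iso f g r e e' -> s + t <= r -> {subset e1 <= ball s [set:: e]} ->
  local_iso f g t e1 (map f e1).
Proof.
move=> isofg le_st_r sub_e1.
have [e'E fP gP adj_f] := isofg.
have sub_t : ball t [set:: e1] \subset ball r [set:: e].
  apply: subset_trans (ball_leq _ le_st_r); rewrite addnC ballD ballS //.
  by apply/subsetP=> x; rewrite inE; apply: sub_e1.
have sub_t' : ball t [set:: map f e1] \subset ball r [set:: e'].
  apply: subset_trans (ball_leq _ le_st_r); rewrite addnC ballD ballS //.
  apply/subsetP=> y; rewrite inE => /mapP[x /sub_e1 ex ->].
  rewrite -e'E -set_seq_map; apply: local_iso_ball isofg _ _ ex.
  by apply: ball_leq; apply: leq_trans le_st_r; apply: leq_addr.
have gK : map g (map f e1) = e1.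
  rewrite -map_comp map_id_in // => x /sub_e1 ex /=.
  case: (fP x) => //; apply: subsetP ex; apply: ball_leq.
  by apply: leq_trans le_st_r; apply: leq_addr.
split=> // [x Bx|y By|x y Bx By].
- have [_ -> ->] := fP x (subsetP sub_t x Bx); split=> //.
  by rewrite -set_seq_map; apply: local_iso_ball isofg _ _ Bx.
- have [_ ->] := gP y (subsetP sub_t' y By); split=> //.
  rewrite -gK -set_seq_map.
  by apply: local_iso_ball (local_iso_sym isofg) _ _ By.
- by rewrite adj_f ?(subsetP sub_t).
Qed.

Lemma locally_iso_leq r s e e' :
  s <= r -> locally_iso r e e' -> locally_iso s e e'.
Proof.
move=> le_sr [f [g isofg]]; exists f, g.
rewrite -(liso_map isofg).
by apply: (local_iso_restrict (s := 0) isofg) => // x; rewrite inE.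
Qed.

Lemma set_seq_cat e1 e2 : [set:: e1 ++ e2] = [set:: e1] :|: [set:: e2].
Proof. by apply/setP=> x; rewrite !inE mem_cat. Qed.

Lemma disjoint_ballSl r (A B : {set G}) :
  [disjoint ball r.+1 A & ball r B] -> [disjoint ball r A & ball r B].
Proof. exact/disjointWl/ball_leq. Qed.

Lemma disjoint_ball_adj r (A B : {set G}) x y :
  [disjoint ball r.+1 A & ball r B] -> x \in ball r A -> y \in ball r B ->
  adj x y = false.
Proof.
move=> dis Ax By; apply/negP=> xy.
have /negP[] := negbT (disjointFl dis By).
by apply/in_ballS; exists x; rewrite // xy orbT.
Qed.

(** Radius [r.+1] on one side excludes not only common vertices but also edges between the two balls
    of radius [r], so the two isomorphisms can be glued. *)
Lemma locally_iso_cat r e1 e1' e2 e2' :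
    locally_iso r e1 e1' -> locally_iso r e2 e2' ->
    [disjoint ball r.+1 [set:: e1] & ball r [set:: e2]] ->
    [disjoint ball r.+1 [set:: e1'] & ball r [set:: e2']] ->
  locally_iso r (e1 ++ e2) (e1' ++ e2').
Proof.
move=> [f1 [g1 [e1E fP1 gP1 adj1]]] [f2 [g2 [e2E fP2 gP2 adj2]]] dis dis'.
have [disr disr'] := (disjoint_ballSl dis, disjoint_ballSl dis').
have n2 x := disjointFl (x := x) disr; have n2' x := disjointFl (x := x) disr'.
have adj12 x y := disjoint_ball_adj (x := x) (y := y) dis.
have adj12' x y := disjoint_ball_adj (x := x) (y := y) dis'.
exists (fun x => if x \in ball r [set:: e1] then f1 x else f2 x).
exists (fun y => if y \in ball r [set:: e1'] then g1 y else g2 y).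
split=> [|x|y|x y]; rewrite ?set_seq_cat ?ballU ?inE.
- rewrite map_cat -e1E -e2E; congr (_ ++ _).
    by apply/eq_in_map=> x ex; rewrite seq_sub_ball.
  by apply/eq_in_map=> x ex; rewrite n2 // seq_sub_ball.
- case: ifP => [Bx _|_ /= Bx].
    by have [B' gf colf] := fP1 x Bx; rewrite B'.
  by have [B' gf colf] := fP2 x Bx; rewrite B' n2' ?orbT.
- case: ifP => [By _|_ /= By].
    by have [B' fg] := gP1 y By; rewrite B'.
  by have [B' fg] := gP2 y By; rewrite B' n2 ?orbT.
- case: ifP => [Bx _|_ /= Bx]; case: ifP => [By _|_ /= By].
  + exact: adj1.
  + have [[Bfx _ _] [Bfy _ _]] := (fP1 x Bx, fP2 y By).
    by rewrite (adj12 _ _ Bx By); apply: adj12'.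
  + have [[Bfx _ _] [Bfy _ _]] := (fP2 x Bx, fP1 y By).
    by rewrite adj_sym [RHS]adj_sym (adj12 _ _ By Bx); apply: adj12'.
  + exact: adj2.
Qed.

Lemma disjoint_ball_far r (A : {set G}) c :
  c \notin ball (2 * r + 1) A -> [disjoint ball r.+1 [set c] & ball r A].
Proof.
apply: contraR => /pred0Pn[z /andP[/= cz Az]].
have -> : 2 * r + 1 = r.+1 + r by lia.
rewrite ballD; have: c \in ball r.+1 [set z] by rewrite ball_sym.
apply/subsetP/ballS.
by rewrite sub1set.
Qed.

(* If [c] is far from [e] but close to [e'], the inverse [g] of the isomorphism
   maps the elements of the orbit of [c] to elements with the same
   neighborhood type; as [g] is injective near [e'] and [c] is not close to [e],
   this orbit must leave the ball around [e']. *)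
Lemma locally_iso_extend r e e' c :
  locally_iso (3 * r + 1) e e' -> exists c', locally_iso r (c :: e) (c' :: e').
Proof.
move=> [f [g isofg]]; have [fE fP gP _] := isofg.
(* Beyond distance [s], the ball of radius [r.+1] around a point misses the ball of radius [r]
   around the tuple. Within distance [s], the radius [s + r] leaves room for a ball of radius
   [r]. *)
pose s := 2 * r + 1.
have le_sr : s + r <= 3 * r + 1 by rewrite /s; lia.
have [Bc|nBc] := boolP (c \in ball s [set:: e]).
  exists (f c), f, g; rewrite -fE -map_cons.
  apply: local_iso_restrict isofg le_sr _ => x.
  by rewrite inE => /predU1P[->//|]; apply: seq_sub_ball.
have iso_e : locally_iso r e e'.
  by apply: (@locally_iso_leq (3 * r + 1)); [lia | exists f, g].
have isogf := local_iso_sym isofg.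
have iso_g y : y \in ball s [set:: e'] -> locally_iso r [:: y] [:: g y].
  move=> By; exists g, f; apply: (local_iso_restrict isogf le_sr) => x.
  by rewrite inE => /eqP->.
have le_s : s <= 3 * r + 1 by rewrite /s; lia.
have B_g y : y \in ball s [set:: e'] -> g y \in ball s [set:: e].
  rewrite -(liso_map isogf) -set_seq_map.
  by apply: local_iso_ball isogf _ _; apply: ball_leq.
pose step x y := (x \in ball s [set:: e']) && (y == g x).
pose X := [set y | connect step c y].
have iso_X y : y \in X -> locally_iso r [:: c] [:: y].
  rewrite inE => /connectP[p]; elim/last_ind: p y => [|p x IHp] y /=.
    by move=> _ ->; apply: locally_iso_refl.
  rewrite rcons_path last_rcons => /andP[cp /andP[Bz /eqP xE]] ->.
  by rewrite xE; apply: locally_iso_trans (IHp _ cp erefl) (iso_g _ Bz).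
have [/subsetP sXB|/subsetPn[c' Xc' nBc']] :=
  boolP (X \subset ball s [set:: e']).
  have gK : {in X, cancel g f}.
    by move=> x /sXB Bx; have [] := gP x (subsetP (ball_leq _ le_s) x Bx).
  (* An injection of the finite set [X] into itself is onto, so [c] would be the image under [g] of
     a point close to [e'], hence close to [e]. *)
  have gX : g @: X = X.
    apply/eqP; rewrite eqEcard (card_in_imset (can_in_inj gK)) leqnn andbT.
    apply/subsetP=> _ /imsetP[x Xx ->]; move: (Xx).
    rewrite !inE => /connect_trans; apply.
    by apply: connect1; rewrite /step sXB ?eqxx.
  have: c \in X by rewrite inE connect0.
  by rewrite -gX => /imsetP[x /sXB/B_g Bgx cE]; rewrite cE Bgx in nBc.
exists c'; apply: (locally_iso_cat (e1 := [:: c]) (e1' := [:: c'])) => //.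
- exact: iso_X.
- by rewrite set_seq1; apply: disjoint_ball_far.
- by rewrite set_seq1; apply: disjoint_ball_far.
Qed.

(** For distant points, the type of a pair is determined by the types of its two members. *)
Lemma locally_iso_pair r x y x' y' :
  locally_iso r [:: x] [:: x'] -> locally_iso r [:: y] [:: y'] ->
  x \notin ball (2 * r + 1) [set y] -> x' \notin ball (2 * r + 1) [set y'] ->
  locally_iso r [:: x; y] [:: x'; y'].
Proof.
move=> isox isoy nBx nBx'; apply: (locally_iso_cat isox isoy);
  by rewrite !set_seq1; apply: disjoint_ball_far.
Qed.

End LocalIsomorphisms.

(** [U] may be infinite; keeping only the symbols that occur leaves finitely many colors, hence
    finitely many neighborhood types. *)
Fixpoint symbols_of (U : Type) n (phi : formula U n) : seq U :=
  match phi with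
  | FEq _ _ _ | FAdj _ _ _ => [::]
  | FCol _ u _ => [:: u]
  | FNot _ p => symbols_of p
  | FAnd _ p q => symbols_of p ++ symbols_of q
  | FEx _ p => symbols_of p
  end.

(** A quantifier costs the radius that [locally_iso_extend] consumes to add one point. *)
Fixpoint locality_radius (U : Type) n (phi : formula U n) : nat :=
  match phi with
  | FEq _ _ _ | FAdj _ _ _ | FCol _ _ _ => 0
  | FNot _ p => locality_radius p
  | FAnd _ p q => maxn (locality_radius p) (locality_radius q)
  | FEx _ p => 3 * locality_radius p + 1
  end.

Section Locality.
Variables (U : Type) (G : colored_graph U).

Definition colors_at (us : seq U) (x : G) : (size us).-tuple bool :=
  map_tuple (fun u => color u x) (in_tuple us).

Lemma tnth_map_eq n (f : G -> G) (e e' : n.-tuple G) :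
  map f e = e' -> forall i, tnth e' i = f (tnth e i).
Proof.
move=> fE i; rewrite (tnth_nth (tnth e i)) -fE.
by rewrite (nth_map (tnth e i)) ?size_tuple // -tnth_nth.
Qed.

Lemma colors_at_cat us vs x y :
  colors_at (us ++ vs) x = colors_at (us ++ vs) y ->
  colors_at us x = colors_at us y /\ colors_at vs x = colors_at vs y.
Proof.
move/(congr1 val)=> /eqP /=; rewrite !map_cat eqseq_cat ?size_map //.
by case/andP=> /eqP eq_us /eqP eq_vs; split; apply: val_inj.
Qed.

(** A back-and-forth argument: in the quantifier case, a witness on either side is answered by
    [locally_iso_extend], applied to the isomorphism or to its inverse. *)
Lemma sat_locally_iso (K : Type) (col : G -> K) n (phi : formula U n)
    (e e' : n.-tuple G) :
    (forall x y, col x = col y ->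
       colors_at (symbols_of phi) x = colors_at (symbols_of phi) y) ->
    locally_iso col (locality_radius phi) e e' ->
  sat phi e = sat phi e'.
Proof.
elim: phi e e' => {n} [n i j|n i j|n u i|n p IHp|n p IHp q IHq|n p IHp] e e' /=
  col_ok iso_ee'.
- case: iso_ee' => f [g [fE fP _ _]].
  have tnthE := tnth_map_eq fE.
  have /inj_in_eq fI : {in [set:: e] &, injective f}.
    by apply: (can_in_inj (g := g)) => x Bx; case: (fP x Bx).
  by rewrite !tnthE fI ?inE ?mem_tnth.
- case: iso_ee' => f [g [fE _ _ adj_f]].
  have tnthE := tnth_map_eq fE.
  by rewrite !tnthE adj_f ?inE ?mem_tnth.
- case: iso_ee' => f [g [fE fP _ _]].
  have tnthE := tnth_map_eq fE.
  have [|_ _ /col_ok] := fP (tnth e i); first by rewrite inE mem_tnth.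
  by rewrite tnthE => /(congr1 val) [].
- by rewrite (IHp _ _ _ iso_ee').
- rewrite (IHp e e') ?(IHq e e') //.
  + by move=> x y /col_ok/colors_at_cat[].
  + by apply: locally_iso_leq iso_ee'; apply: leq_maxr.
  + by move=> x y /col_ok/colors_at_cat[].
  + by apply: locally_iso_leq iso_ee'; apply: leq_maxl.
- apply/existsP/existsP=> -[c].
    have [c' iso_c] := locally_iso_extend c iso_ee'.
    by rewrite (IHp _ [tuple of c' :: e']) //; exists c'.
  have [c' iso_c] := locally_iso_extend c (locally_iso_sym iso_ee').
  by rewrite (IHp _ [tuple of c' :: e]) //; exists c'.
Qed.

End Locality.

(** * Finitely many neighborhood types *)

Section NeighborhoodTypes.
Variables (N r : nat) (K : finType) (G : graph) (col : G -> K).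

(** The components are the size of the ball, the position of its center, its adjacency matrix and
    its colors. *)
Definition neighborhood_type : finType :=
  ('I_N.+1 * 'I_N.+1 * {ffun 'I_N.+1 * 'I_N.+1 -> bool} *
   {ffun 'I_N.+1 -> K})%type.

(* The ball around [x] is enumerated; positions beyond its size carry the junk
   vertex [x], which is harmless as the size is recorded. *)
Definition neighborhood (x : G) : neighborhood_type :=
  let s := enum (ball r [set x]) in
  (inord (size s), inord (index x s),
   [ffun ij : 'I_N.+1 * 'I_N.+1 => adj (nth x s ij.1) (nth x s ij.2)],
   [ffun i : 'I_N.+1 => col (nth x s i)]).

Lemma neighborhood_iso x y :
  (forall z : G, #|ball r [set z]| <= N) ->
  neighborhood x = neighborhood y -> locally_iso col r [:: x] [:: y].
Proof.
move=> leN; set s := enum (ball r [set x]); set t := enum (ball r [set y]).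
have [sN tN] : size s <= N /\ size t <= N by rewrite -!cardE.
case=> /(congr1 val) /=; rewrite !inordK ?ltnS // => st.
move=> /(congr1 val) /=; rewrite !inordK ?ltnS ?(leq_trans (index_size _ _)) //.
move=> ixy adjst colst.
have us : uniq s by apply: enum_uniq.
have ut : uniq t by apply: enum_uniq.
rewrite -/s -/t in st ixy adjst colst.
have adjE i j : i < size s -> j < size s ->
    adj (nth x s i) (nth x s j) = adj (nth y t i) (nth y t j).
  move=> lti ltj; have /ffunP/(_ (inord i, inord j)) := adjst.
  by rewrite !ffunE /= !inordK // ltnS (leq_trans _ sN) // ltnW.
have colE i : i < size s -> col (nth x s i) = col (nth y t i).
  move=> lti; have /ffunP/(_ (inord i)) := colst.
  by rewrite !ffunE /= !inordK // ltnS (leq_trans _ sN) // ltnW.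
have xs : x \in s by rewrite mem_enum (subsetP (ball_leq _ (leq0n r))) ?inE.
have yt : y \in t by rewrite mem_enum (subsetP (ball_leq _ (leq0n r))) ?inE.
have memE z w : (w \in ball r [set z]) = (w \in enum (ball r [set z])).
  by rewrite mem_enum.
exists (fun z => nth y t (index z s)), (fun z => nth x s (index z t)).
split=> [|z|z|z w]; rewrite ?set_seq1 ?memE -/s -/t /=.
- by rewrite ixy nth_index.
- move=> zs; have lti : index z s < size s by rewrite index_mem.
  by rewrite mem_nth -?st // index_uniq -?st // -colE ?nth_index.
- move=> zt; have lti : index z t < size t by rewrite index_mem.
  by rewrite mem_nth ?st // index_uniq ?st // nth_index.
- move=> zs ws; rewrite -adjE ?index_mem //.
  by rewrite !nth_index.
Qed.

End NeighborhoodTypes.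

(** * From transductions to perturbations *)

(* Complementing [A :|: [set m]] and then [A] exchanges the edges and
   non-edges between [m] and [A], up to the pair [(m, m)]. *)
Lemma symmetric_rel_flips m (f : rel nat) : symmetric f ->
  exists2 Ms : seq (pred nat), size Ms = 3 * m &
    forall x y, x < m -> y < m ->
      odd (count (fun M : pred nat => M x && M y) Ms) = f x y.
Proof.
move=> f_sym; elim: m => [|m [Ms szMs fE]]; first by exists [::].
pose A x := (x < m) && f x m.
pose Ns := [seq (fun x => (x < m) && M x) | M : pred nat <- Ms].
(* On the pair [(m, m)] the first set counts one and the second none, as [A] lies below [m]; the
   third set corrects this when [f m m] is false. The earlier sets, cut down to indices below [m],
   do not interfere. *)
exists [:: (fun x => (x == m) || A x), A, (fun x => (x == m) && ~~ f m m)
         & Ns : seq (pred nat)].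
  by rewrite /= size_map szMs; lia.
move=> x y; rewrite (ltnS x) (ltnS y) /= count_map !oddD !oddb.
have -> : count (preim (fun M : pred nat => fun x => (x < m) && M x)
                   (fun M : pred nat => M x && M y)) Ms =
    if (x < m) && (y < m) then count (fun M : pred nat => M x && M y) Ms else 0.
  case: ifP => [/andP[ltx lty]|n_lt].
    by apply: eq_count => M /=; rewrite ltx lty.
  rewrite -(count_pred0 Ms); apply: eq_count => M /=; apply: contraFF n_lt.
  by case/andP=> /andP[-> _] /andP[-> _].
rewrite (leq_eqVlt x) (leq_eqVlt y) /A.
have [->|nx] /= := eqVneq x m; have [->|ny] /= := eqVneq y m; rewrite ?ltnn /=.
- by case: (f m m).
- by move=> _ ->; rewrite f_sym !andbF !addbF.
- by move=> -> _; rewrite !andbF !addbF andbT.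
- by move=> ltx lty; rewrite ltx lty fE //= addbA addbb.
Qed.

Lemma degree_copy k d (G : graph) :
  (forall x : G, degree x <= d) -> forall p : copy k G, degree p <= d + k.
Proof.
move=> deg_d [x i]; rewrite /degree.
pose A := [set (y, i) | y in [set y | adj x y]] : {set copy k G}.
pose B := [set (x, j) | j : 'I_k] : {set copy k G}.
have /subset_leq_card/leq_trans-> // :
    [set q | adj ((x, i) : copy k G) q] \subset A :|: B.
  apply/subsetP=> -[y j]; rewrite !inE /= /copy_adj /=.
  case/orP=> /andP[/eqP<- xy]; apply/orP; [left | right].
    by apply: imset_f; rewrite inE.
  exact: imset_f.
apply: leq_trans (leq_card_setU _ _) (leq_add _ _).
  exact: leq_trans (leq_imset_card _ _) (deg_d x).
by apply: leq_trans (leq_imset_card _ _) _; rewrite card_ord.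
Qed.

Lemma interpret_flips (U : Type) (I : interpretation U) (d : nat) :
  exists n d', forall G : colored_graph U, (forall x : G, degree x <= d) ->
    exists2 Ms : seq (pred (interpret I G)),
      size Ms = n & forall x : flips Ms, degree x <= d'.
Proof.
pose r := locality_radius (eta I); pose R := 2 * r + 1.
pose K := {: (size (symbols_of (eta I))).-tuple bool}.
pose N := d.+1 ^ r; pose T := neighborhood_type N K.
(* Three sets are spent per neighborhood type. After the flips all neighbors of a vertex lie in its
   ball of radius [R], whose size gives the degree bound. *)
exists (3 * #|T|), (d.+1 ^ R) => G deg_d.
pose col : G -> K := colors_at (symbols_of (eta I)).
pose tp (x : G) : T := neighborhood N r col x.
have tpP x y : tp x = tp y -> locally_iso col r [:: x] [:: y].
  by apply: neighborhood_iso => z; apply: card_ball.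
pose rk (x : G) : nat := enum_rank (tp x).
have rkP x y : rk x = rk y -> locally_iso col r [:: x] [:: y].
  by move=> /val_inj/enum_rank_inj/tpP.
have far_sym x y : (x \in ball R [set y]) = (y \in ball R [set x]).
  exact: ball_sym.
(* Two types are related when some distant pair of these types satisfies [eta I]; by locality
   ([f_far]) every distant pair of these types then does. *)
pose f : rel nat := fun s t =>
  [exists x : G, exists y : G, [&& rk x == s, rk y == t,
     x \notin ball R [set y] & sat (eta I) [tuple x; y]]].
have f_sym : symmetric f.
  suff f_sub s t : f s t -> f t s by move=> s t; apply/idP/idP; apply: f_sub.
  case/existsP=> x /existsP[y /and4P[xs yt far xy]].
  apply/existsP; exists y; apply/existsP; exists x.
  by rewrite xs yt far_sym far eta_sym.
have f_far x y : x \notin ball R [set y] ->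
    f (rk x) (rk y) = sat (eta I) [tuple x; y].
  move=> far; apply/idP/idP=> [|xy].
    case/existsP=> x' /existsP[y' /and4P[/eqP/rkP iso_x /eqP/rkP iso_y far']].
    rewrite (@sat_locally_iso _ _ _ col _ _ _ [tuple x; y]) //.
    exact: locally_iso_pair.
  by apply/existsP; exists x; apply/existsP; exists y; rewrite !eqxx far.
have [Ms szMs MsP] := symmetric_rel_flips #|T| f_sym.
exists [seq (fun x => M (rk (val x))) | M : pred nat <- Ms].
  by rewrite size_map.
move=> x; apply: leq_trans (card_ball R (val x) deg_d).
rewrite /degree -(card_imset _ val_inj); apply: subset_leq_card.
apply/subsetP=> _ /imsetP[y + ->]; rewrite !inE /= /flips_adj count_map.
(* For a distant pair of distinct vertices the flips add the value of [eta I] to itself, so no edge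
   remains. *)
apply: contraLR; rewrite -far_sym => far.
have rk_lt z : rk z < #|T| by apply: ltn_ord.
rewrite -[count _ Ms]/(count (fun M : pred nat =>
  M (rk (val x)) && M (rk (val y))) Ms).
rewrite MsP // f_far // /interpret_adj.
have [xy|_] := eqVneq x y; last by rewrite addbb.
by rewrite xy adj_irr.
Qed.

Theorem transduction_perturbation (C D : graph -> Prop) :
  bounded_degree D -> FO_transduction_of C D ->
  exists D' : graph -> Prop,
    [/\ graph_class D', bounded_degree D' & perturbation_of C D'].
Proof.
move=> [d degD] [T CT].
have [n [d' flipsP]] := interpret_flips (interp T) (d + copies T).
pose D' (G : graph) := forall x : G, degree x <= d'.
have D'cl : iso_closed D' by move=> G H isoGH D'G; apply: degree_iso isoGH D'G.
exists D'; split.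
- split=> // G G0 x; have := fintype0 x; by rewrite G0 => /(_ erefl).
- by exists d'.
exists n => G /CT[K DK [c isoKG]].
apply: iter_transduce_iso_closed isoKG _ => //.
apply/perturbation_flips => //.
have [Ms] := flipsP (ColoredGraph _ c) (degree_copy (degD K DK)).
by exists Ms.
Qed.

(** * Encoding into cubic graphs *)

Section RegularPadding.
Variables (d : nat) (G : graph).
Hypothesis deg_d : forall x : G, degree x <= d.

Definition toggle (s : {ffun 'I_d -> bool}) (i : 'I_d) : {ffun 'I_d -> bool} :=
  [ffun j => s j (+) (j == i)].

Lemma toggleK s i : toggle (toggle s i) i = s.
Proof. by apply/ffunP=> j; rewrite !ffunE -addbA addbb addbF. Qed.

Lemma toggle_neq s i : (s == toggle s i) = false.
Proof.
by apply/eqP=> /ffunP/(_ i); rewrite ffunE eqxx; case: (s i).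
Qed.

Lemma toggle_inj s : injective (toggle s).
Proof.
move=> i j /ffunP/(_ i); rewrite !ffunE eqxx.
by case: eqP => // _; case: (s i).
Qed.

(** Copies of [G] are indexed by the vertices of the [d]-dimensional cube. A vertex of degree [k] is
    joined to its own copies along the first [d - k] directions of the cube, which supplies exactly
    its missing edges. *)
Definition padding_adj : rel (G * {ffun 'I_d -> bool}) := fun p q =>
  (p.2 == q.2) && adj p.1 q.1 ||
  (p.1 == q.1) &&
    [exists i : 'I_d, (i < d - degree p.1) && (q.2 == toggle p.2 i)].

Lemma padding_adj_sym : symmetric padding_adj.
Proof.
move=> [x s] [y t]; rewrite /padding_adj /= adj_sym (eq_sym s) (eq_sym x).
congr (_ || _); case: eqP => //= <-; apply: eq_existsb => i; congr (_ && _).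
by apply/eqP/eqP => ->; rewrite toggleK.
Qed.

Lemma padding_adj_irr : irreflexive padding_adj.
Proof.
move=> [x s]; rewrite /padding_adj /= adj_irr andbF eqxx /=.
by apply/existsP=> -[i]; rewrite toggle_neq andbF.
Qed.

Definition padding : graph := Graph padding_adj_sym padding_adj_irr.

Lemma degree_padding (p : padding) : degree p = d.
Proof.
case: p => x s; rewrite /degree.
pose A := [set (y, s) | y in [set y | adj x y]] : {set padding}.
pose B := [set (x, toggle s (widen_ord (leq_subr (degree x) d) i)) |
             i : 'I_(d - degree x)] : {set padding}.
have -> : [set q | adj ((x, s) : padding) q] = A :|: B.
  apply/setP=> -[y t]; rewrite !inE /= /padding_adj /=; congr (_ || _).
    apply/andP/imsetP => [[/eqP<- xy]|[z]]; first by exists y; rewrite ?inE.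
    by rewrite inE => xz [-> ->].
  apply/andP/imsetP => [[/eqP<- /existsP[i /andP[lti /eqP->]]]|[i _ [-> ->]]].
    by exists (Ordinal lti) => //; congr (_, toggle _ _); apply: val_inj.
  split=> //; apply/existsP; exists (widen_ord (leq_subr (degree x) d) i).
  by rewrite eqxx andbT; apply: (ltn_ord i).
have AB0 : A :&: B = set0.
  apply/setP=> q; rewrite !inE.
  apply/andP=> -[/imsetP[y + ->] /imsetP[i _ [yx _]]].
  by rewrite inE yx adj_irr.
rewrite cardsU AB0 cards0 subn0 !card_imset ?cardsT ?card_ord.
- by rewrite subnKC; last apply: deg_d.
- by move=> i j [/toggle_inj/(congr1 val)] /= ij; apply: val_inj.
- by move=> y z [].
Qed.

Lemma padding_embedding : exists2 f : G -> padding,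
  injective f & forall x y : G, adj (f x) (f y) = adj x y.
Proof.
exists (fun x => (x, [ffun=> false])) => [x y []//|x y].
rewrite /= /padding_adj /= eqxx /= orb_idr // => /andP[_ /existsP[i]].
by rewrite toggle_neq andbF.
Qed.

End RegularPadding.

(** * Path gadgets of maximum degree 3 *)

Section Gadget.
Variable G : graph.
Implicit Types u v w : G.

(** Names for the positions on the path of [v]: the first, named [v], is the root that will stand
    for [v], and the one named [u] carries the port towards [u]. *)
Definition spine v : seq G := v :: enum [set u | adj v u].

Lemma spine_uniq v : uniq (spine v).
Proof. by rewrite /= enum_uniq mem_enum inE adj_irr. Qed.

Lemma size_spine v : size (spine v) = (degree v).+1.
Proof. by rewrite /= -cardE. Qed.

Definition spine_step v u w : bool :=
  [&& u \in spine v, w \in spine v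
    & index w (spine v) == (index u (spine v)).+1].

(* [(v, u, false)] lies on the spine of [v], and [(v, u, true)] is the port of
   [v] towards [u]; if [u] is neither [v] nor one of its neighbors, these two
   vertices form a separate component. *)
Definition gadget_adj : rel (G * G * bool) := fun p q =>
  let: (v, u, b) := p in let: (v', u', b') := q in
  if b != b' then (v == v') && (u == u')
  else if b then [&& v == u', u == v' & adj v u]
  else (v == v') && (spine_step v u u' || spine_step v u' u).

Lemma gadget_adj_sym : symmetric gadget_adj.
Proof.
move=> [[v u] b] [[v' u'] b'] /=; rewrite (eq_sym b) (eq_sym v) (eq_sym u).
case: eqP => //= ->; case: ifP => _.
  rewrite (eq_sym u') (eq_sym v' u).
  by case: (v =P u') => [->|_]; case: (u =P v') => [->|_] //=; rewrite adj_sym.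
by rewrite orbC; case: (v' =P v) => [->|_].
Qed.

Lemma gadget_adj_irr : irreflexive gadget_adj.
Proof.
move=> [[v u] b] /=; rewrite eqxx /=; case: b.
  by case: eqP => //= ->; rewrite adj_irr andbF.
by rewrite eqxx orbb /spine_step; apply/negP=> /and3P[_ _]; lia.
Qed.

Definition gadget : graph := Graph gadget_adj_sym gadget_adj_irr.

Lemma degree_gadget (p : gadget) : degree p <= 3.
Proof.
case: p => [[v u] b]; rewrite /degree.
(* At the ends of the path, or off it, [nx] or [pv] need not be a true neighbor; only an upper bound
   on the neighborhood is sought. *)
pose nx := nth v (spine v) (index u (spine v)).+1.
pose pv := nth v (spine v) (index u (spine v)).-1.
pose N := if b then [:: (v, u, false); (u, v, true)]
  else [:: (v, u, true); (v, nx, false); (v, pv, false)].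
have leN : size N <= 3 by rewrite /N; case: (b).
apply: leq_trans leN; apply: leq_trans (card_size N).
apply/subset_leq_card/subsetP => -[[v' u'] b']; rewrite inE {}/N /=.
case: b; case: b' => //=; rewrite !inE.
- by case/and3P=> /eqP-> /eqP->; rewrite eqxx orbT.
- by case/andP=> /eqP-> /eqP->; rewrite eqxx.
- by case/andP=> /eqP-> /eqP->; rewrite eqxx.
case/andP=> /eqP<- /orP[] /and3P[uv uv' /eqP ix].
  have -> : nx = u' by rewrite /nx -ix nth_index.
  by rewrite eqxx !orbT.
have -> : pv = u' by rewrite /pv ix nth_index.
by rewrite eqxx !orbT.
Qed.

End Gadget.

(** [Root] marks the vertices that survive the interpretation and [Flip i] the [i]-th set to
    complement. [Spine] and [Port] also keep walks from straying out of the embedded gadget into the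
    rest of the padding. *)
Inductive symbol := Root | Spine | Port | Flip of nat.

(** * First-order decoding of gadgets *)

Section Formulas.
Variables (G : colored_graph symbol).

(** Walks of at most [d.+1] edges with inner vertices on spines: up to [d] steps along a path of at
    most [d.+1] vertices, then one onto a port. *)
Fixpoint reaches (d : nat) (x q : G) : bool :=
  adj x q || (if d is d'.+1 then
    [exists z, color Spine z && adj x z && reaches d' z q] else false).

Definition linked (d : nat) (x y : G) : bool :=
  [exists q, exists q', [&& reaches d x q, reaches d y q',
     color Port q, color Port q' & adj q q']].

Lemma linked_sym d x y : linked d x y = linked d y x.
Proof.
suff sub u v : linked d u v -> linked d v u by apply/idP/idP; apply: sub.
case/existsP=> q /existsP[q' /and5P[uq vq' pq pq' qq']].
apply/existsP; exists q'; apply/existsP; exists q.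
by rewrite uq vq' pq pq' adj_sym.
Qed.

End Formulas.

Fixpoint reaches_formula (d n : nat) (i j : 'I_n) : formula symbol n :=
  if d is d'.+1 then
    FNot (FAnd (FNot (FAdj i j)) (FNot (FEx
      (FAnd (FAnd (FCol Spine ord0) (FAdj (lift ord0 i) ord0))
            (reaches_formula d' ord0 (lift ord0 j))))))
  else FAdj i j.

Definition linked_formula (d n : nat) (i j : 'I_n) : formula symbol n :=
  let q : 'I_n.+2 := lift ord0 ord0 in let q' : 'I_n.+2 := ord0 in
  FEx (FEx (FAnd (reaches_formula d (lift ord0 (lift ord0 i)) q)
    (FAnd (reaches_formula d (lift ord0 (lift ord0 j)) q')
    (FAnd (FCol Port q) (FAnd (FCol Port q') (FAdj q q')))))).

(** The nested negations spell the exclusive or of [psi] and [both]. *)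
Fixpoint flipped_formula (phi : formula symbol 2) (n : nat) :
    formula symbol 2 :=
  if n is n'.+1 then
    let psi := flipped_formula phi n' in
    let both := FAnd (FCol (Flip n') ord0) (FCol (Flip n') ord_max) in
    FNot (FAnd (FNot (FAnd psi (FNot both))) (FNot (FAnd (FNot psi) both)))
  else phi.

Definition decode_eta (d n : nat) : formula symbol 2 :=
  FAnd (FNot (FEq ord0 ord_max))
       (flipped_formula (linked_formula d ord0 ord_max) n).

Lemma sat_reaches (G : colored_graph symbol) d n (i j : 'I_n) (e : n.-tuple G) :
  sat (reaches_formula d i j) e = reaches d (tnth e i) (tnth e j).
Proof.
elim: d n i j e => [|d IHd] n i j e /=; first by rewrite orbF.
rewrite negb_and !negbK; congr (_ || _); apply: eq_existsb => z.
by rewrite IHd tnth0 !tnthS.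
Qed.

Lemma sat_linked (G : colored_graph symbol) d n (i j : 'I_n) (e : n.-tuple G) :
  sat (linked_formula d i j) e = linked d (tnth e i) (tnth e j).
Proof.
rewrite /linked_formula /=; apply: eq_existsb => q; apply: eq_existsb => q'.
by rewrite !sat_reaches !tnthS !tnth0.
Qed.

Lemma sat_flipped (G : colored_graph symbol) phi n (x y : G) :
  sat (flipped_formula phi n) [tuple x; y] = sat phi [tuple x; y]
    (+) odd (count (fun i => color (Flip i) x && color (Flip i) y) (iota 0 n)).
Proof.
elim: n => [|n IHn]; first by rewrite addbF.
have -> : iota 0 n.+1 = rcons (iota 0 n) n by rewrite -addn1 iotaD cats1.
rewrite -cats1 count_cat oddD addbA -IHn /= addn0 oddb !(tnth_nth x) /=.
by case: (sat _ _); case: (color _ x); case: (color _ y).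
Qed.

Lemma sat_decode (G : colored_graph symbol) d n (x y : G) :
  sat (decode_eta d n) [tuple x; y] = (x != y) && (linked d x y
    (+) odd (count (fun i => color (Flip i) x && color (Flip i) y) (iota 0 n))).
Proof. by rewrite /= sat_flipped sat_linked !(tnth_nth x). Qed.

Lemma decode_sym d n (G : colored_graph symbol) (x y : G) :
  sat (decode_eta d n) [tuple x; y] = sat (decode_eta d n) [tuple y; x].
Proof.
rewrite !sat_decode eq_sym linked_sym; congr (_ && (_ (+) odd _)).
by apply: eq_count => i; rewrite andbC.
Qed.

Lemma decode_irr d n (G : colored_graph symbol) (x : G) :
  sat (decode_eta d n) [tuple x; x] = false.
Proof. by rewrite sat_decode eqxx. Qed.

Definition decode_nu : formula symbol 1 := FCol Root ord0.

Definition decode (d n : nat) : transduction :=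
  @Transduction 1 isT symbol
    (@Interpretation symbol decode_nu (decode_eta d n)
       (@decode_sym d n) (@decode_irr d n)).

Section Decoding.
Variables (d : nat) (G : graph) (Q : colored_graph symbol) (f : gadget G -> Q).
Hypotheses (deg_d : forall x : G, degree x <= d) (f_inj : injective f).
Hypothesis adj_f : forall p q : gadget G, adj (f p) (f q) = adj p q.
Hypothesis colorSpine :
  forall z : Q, color Spine z = [exists a : G * G, z == f (a, false)].
Hypothesis colorPort :
  forall z : Q, color Port z = [exists a : G * G, z == f (a, true)].

(** Different spines are never adjacent, so a walk through spine vertices cannot leave the path of
    [v] before its last edge. *)
Lemma reaches_own_port k (v w : G) q :
  reaches k (f (v, w, false)) q -> color Port q -> exists u, q = f (v, u, true).
Proof.
have adjP u q' : adj (f (v, u, false)) q' -> color Port q' ->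
    exists u, q' = f (v, u, true).
  rewrite colorPort => + /existsP[[v' u'] /eqP q'E]; rewrite q'E adj_f /=.
  by case/andP=> /eqP-> _; exists u'.
elim: k w => [|k IHk] w /=; first by rewrite orbF; apply: adjP.
case/orP=> [/adjP //|/existsP[z /andP[/andP[]]]].
rewrite colorSpine => /existsP[[v' u'] /eqP->]; rewrite adj_f /=.
by case/andP=> /eqP <- _; apply: IHk.
Qed.

Lemma reaches_port k (v : G) i j :
  j - i <= k -> i <= j -> j < size (spine v) ->
  reaches k (f (v, nth v (spine v) i, false)) (f (v, nth v (spine v) j, true)).
Proof.
move=> le_k le_ij lt_j; elim: k i le_k le_ij => [|k IHk] i le_k le_ij.
  have -> : i = j by lia.
  by rewrite [reaches _ _ _]/= adj_f /= !eqxx.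
rewrite [reaches _ _ _]/= adj_f; have [->|neq_ij] := eqVneq i j.
  by rewrite /= !eqxx.
apply/orP; right; apply/existsP; exists (f (v, nth v (spine v) i.+1, false)).
have lt_i : i.+1 < size (spine v) by lia.
rewrite colorSpine IHk ?andbT; [|lia|lia].
apply/andP; split; first by apply/existsP; exists (v, nth v (spine v) i.+1).
rewrite adj_f; apply/andP; split=> //; apply/orP; left.
rewrite /spine_step !mem_nth ?index_uniq ?spine_uniq ?eqxx //;
  by rewrite ?lt_i ?(ltnW lt_i).
Qed.

Lemma reaches_neighbor (v u : G) :
  adj v u -> reaches d (f (v, v, false)) (f (v, u, true)).
Proof.
move=> vu; have u_spine : u \in spine v by rewrite !inE mem_enum inE vu orbT.
have := @reaches_port d v 0 (index u (spine v)).
rewrite nth_index // index_mem subn0 => -> //.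
rewrite -ltnS; apply: leq_trans (_ : (degree v).+1 <= _); last exact: deg_d.
by rewrite -size_spine index_mem.
Qed.

(** The ports reached from the two roots belong to [v] and [u], and two such ports are adjacent only
    when they are matched by an edge between [v] and [u]. *)
Lemma linked_gadget (v u : G) :
  linked d (f (v, v, false)) (f (u, u, false)) = adj v u.
Proof.
have port a : color Port (f (a, true)).
  by rewrite colorPort; apply/existsP; exists a.
apply/existsP/idP => [[q /existsP[q' /and5P[vq uq' pq pq']]]|vu].
  have [w ->] := reaches_own_port vq pq.
  have [w' ->] := reaches_own_port uq' pq'.
  by rewrite adj_f /= => /and3P[_ /eqP->].
exists (f (v, u, true)); apply/existsP; exists (f (u, v, true)).
by rewrite !reaches_neighbor ?port ?adj_f /= ?eqxx // adj_sym.
Qed.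

End Decoding.

(** The encoded graph is [flips Ms], which has small degree; flipping the sets [Ms] a second time,
    through colors on the roots, restores [H]. *)
Lemma decode_flips d (H : graph) (Ms : seq (pred H)) :
  (forall x : flips Ms, degree x <= d) ->
  transduce (decode d (size Ms)) cubic H.
Proof.
set G := flips Ms => deg_d.
have [f f_inj adj_f] := padding_embedding 3 (gadget G).
set Q := padding _ _ in f f_inj adj_f.
exists Q; first by move=> x; apply: degree_padding (@degree_gadget G) x.
pose root (v : G) : Q := f (v, v, false).
pose c (u : symbol) (z : Q) : bool :=
  match u with
  | Root => [exists v, z == root v]
  | Spine => [exists a : G * G, z == f (a, false)]
  | Port => [exists a : G * G, z == f (a, true)]
  | Flip i => [exists v, (z == root v) && nth xpred0 Ms i v]
  end.
exists (fun u p => c u p.1).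
apply/graph_iso_sym; apply: graph_iso_trans (interpret_copy1 _ _).
set Qc := ColoredGraph _ _.
have root_inj : injective root by move=> v u /f_inj[].
have nu_root (v : G) : sat decode_nu ([tuple root v] : 1.-tuple Qc).
  by apply/existsP; exists v.
exists (fun v => exist _ (root v) (nu_root v)).
  apply: inj_surj_bij => [v u [/root_inj] //|[z z_root]].
  have /existsP[v /eqP zE] := z_root.
  by exists v; apply/eqP/val_inj.
have flipE i w : color (Flip i) (root w : Qc) = nth xpred0 Ms i w.
  apply/existsP/idP => [[w' /andP[/eqP/root_inj->]] //|Mw].
  by exists w; rewrite eqxx.
move=> v u; rewrite /= /interpret_adj sat_decode (inj_eq root_inj).
have -> : count (fun i =>
      color (Flip i) (root v : Qc) && color (Flip i) (root u : Qc))
    (iota 0 (size Ms)) = count (fun M : pred H => M v && M u) Ms.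
  rewrite -[Ms in RHS](mkseq_nth xpred0) count_map.
  by apply: eq_count => i; rewrite !flipE.
rewrite (@linked_gadget d G Qc f) //= /flips_adj.
by case: eqVneq => [->|_] /=; rewrite ?adj_irr // -addbA addbb addbF.
Qed.

Theorem proposition14p1 (C : graph -> Prop) (hC : graph_class C) :
  (FO_transduction_of C cubic <->
   exists D : graph -> Prop,
     [/\ graph_class D, bounded_degree D & FO_transduction_of C D]) /\
  ((exists D : graph -> Prop,
     [/\ graph_class D, bounded_degree D & FO_transduction_of C D]) <->
   exists D : graph -> Prop,
     [/\ graph_class D, bounded_degree D & perturbation_of C D]).
Proof.
(* The implications form a cycle: cubic graphs are a class of bounded degree, locality turns a
   transduction into a perturbation, and the gadgets lead back to cubic graphs. *)
have cubic_bounded : FO_transduction_of C cubic ->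
    exists D, [/\ graph_class D, bounded_degree D & FO_transduction_of C D].
  move=> CT; exists cubic; split=> //; last by exists 3 => G cG x; rewrite cG.
  split=> [G H [f [g fK gK] adj_f] cG y|G G0 x]; last first.
    by have := fintype0 x; rewrite G0 => /(_ erefl).
  rewrite -(cG (g y)) /degree -(card_imset _ (can_inj fK)).
  congr #|pred_of_set _|.
  apply/setP=> z; rewrite inE; apply/idP/imsetP => [yz|[x + ->]].
    by exists (g z); rewrite ?inE ?gK // -adj_f !gK.
  by rewrite inE -adj_f gK.
have bounded_perturbation D : bounded_degree D -> FO_transduction_of C D ->
    exists D', [/\ graph_class D', bounded_degree D' & perturbation_of C D'].
  exact: transduction_perturbation.
have perturbation_cubic D : graph_class D -> bounded_degree D ->
    perturbation_of C D -> FO_transduction_of C cubic.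
  move=> [Dcl _] [d degD] [n CP]; exists (decode d n) => G CG.
  have /perturbation_flips[//|Ms <- DMs] := CP G CG.
  by apply: decode_flips; apply: degD.
split; split=> //.
- case=> D [_ bD CT]; have [D' [cD' bD' PD']] := bounded_perturbation D bD CT.
  exact: perturbation_cubic PD'.
- by case=> D [_ bD CT]; apply: bounded_perturbation CT.
- by case=> D [cD bD PD]; apply: cubic_bounded; apply: perturbation_cubic PD.
Qed.
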